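(* Let $\Upsilon$ denote any one of the Menger, Hurewicz or Rothberger properties, and let $(X,\mathbb{U})$ and $(Y,\mathbb{V})$ be uniform spaces with $X$ locally $\Upsilon$-bounded. (1) If $f:(X,\mathbb{U})\to(Y,\mathbb{V})$ is a uniformly continuous, bi-quotient mapping from $X$ onto $Y$, then $Y$ is also locally $\Upsilon$-bounded. (2) If $f:(X,\mathbb{U})\to(Y,\mathbb{V})$ is a uniformly continuous, weakly perfect mapping from $X$ onto $Y$, then $Y$ is also locally $\Upsilon$-bounded.
   Context: A uniformity on a set $X$ is a nonempty family $\mathbb{U}$ of symmetric subsets of $X\times X$ containing the diagonal $\Delta=\{(x,x):x\in X\}$ (entourages) such that: (i) if $U\in\mathbb{U}$ and $V\supseteq U$ is a symmetric subset of $X\times X$, then $V\in\mathbb{U}$; (ii) $U,V\in\mathbb{U}$ implies $U\cap V\in\mathbb{U}$; (iii) for every $U\in\mathbb{U}$ there is $V\in\mathbb{U}$ with $V\circ V\subseteq U$; (iv) $\bigcap\mathbb{U}=\Delta$. The pair $(X,\mathbb{U})$ is a uniform space. For $U\in\mathbb{U}$, $x\in X$, $F\subseteq X$: $U[x]=\{y\in X:(x,y)\in U\}$ and $U[F]=\bigcup_{x\in F}U[x]$. Topological notions refer to the topology in which $O\subseteq X$ is open iff for each $x\in O$ there is $U\in\mathbb{U}$ with $U[x]\subseteq O$. A subset $Y\subseteq X$ is a subspace with the relative uniformity $\mathbb{U}_Y=\{(Y\times Y)\cap U:U\in\mathbb{U}\}$. A uniform space $(X,\mathbb{U})$ is: ${\sf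 M}$-bounded (the case $\Upsilon$ = Menger) if for each sequence $(U_n)_{n\in\mathbb{N}}$ in $\mathbb{U}$ there are finite $F_n\subseteq X$ with $\bigcup_nU_n[F_n]=X$; ${\sf H}$-bounded ($\Upsilon$ = Hurewicz) if for each sequence $(U_n)$ in $\mathbb{U}$ there are finite $F_n\subseteq X$ such that each $x\in X$ belongs to $U_n[F_n]$ for all but finitely many $n$; ${\sf R}$-bounded ($\Upsilon$ = Rothberger) if for each sequence $(U_n)$ in $\mathbb{U}$ there are $x_n\in X$ with $\bigcup_nU_n[x_n]=X$. ''$\Upsilon$-bounded'' denotes the corresponding one of these properties. $X$ is locally $\Upsilon$-bounded if for each $x\in X$ there is $U\in\mathbb{U}$ such that $U[x]$ is a $\Upsilon$-bounded subspace of $X$. A surjective continuous mapping $f:X\to Y$ is weakly perfect if $f$ is closed and $f^{-1}(y)$ is Lindelöf for each $y\in Y$. A surjective continuous mapping $f:X\to Y$ is bi-quotient if whenever $y\in Y$ and $\mathcal{U}$ is a cover of $f^{-1}(y)$ by open sets in $X$, then finitely many $f(U)$ with $U\in\mathcal{U}$ cover some open set containing $y$ in $Y$. *)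

(* Defs.v *)
From mathcomp Require Import all_boot all_classical topology.

Set Implicit Arguments.
Unset Strict Implicit.
Unset Printing Implicit Defensive.

Local Open Scope classical_set_scope.

(* Here the members of a uniformity are symmetric, whereas the filter
   [entourage] of a [uniformType] also contains non-symmetric relations. *)
Definition uniformity (X : uniformType) : set_system (X * X) :=
  [set U | entourage U /\ U^-1%relation = U].

(* The intersection axiom, which [uniformType] does not impose. *)
Definition separated_uniformity (X : uniformType) : Prop :=
  \bigcap_(U in @uniformity X) U = diagonal.

Definition relative_uniformity (X : uniformType) (A : set X) :
    set_system (X * X) :=
  [set (A `*` A) `&` U | U in @uniformity X].

Definition uball (X : Type) (U : set (X * X)) (F : set X) : set X :=
  \bigcup_(x in F) xsection U x.

(* In the next four definitions, a uniform space is given by its set A of points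
   and its uniformity UU, a family of subsets of A `*` A; in this way they apply
   to subspaces. *)
Definition Menger_bounded (X : Type) (A : set X) (UU : set_system (X * X)) :
    Prop :=
  forall U : nat -> set (X * X), (forall n, UU (U n)) ->
  exists F : nat -> set X,
    (forall n, finite_set (F n) /\ F n `<=` A) /\
    \bigcup_n uball (U n) (F n) = A.

Definition Hurewicz_bounded (X : Type) (A : set X) (UU : set_system (X * X)) :
    Prop :=
  forall U : nat -> set (X * X), (forall n, UU (U n)) ->
  exists F : nat -> set X,
    (forall n, finite_set (F n) /\ F n `<=` A) /\
    forall x, A x -> \forall n \near \oo, uball (U n) (F n) x.

Definition Rothberger_bounded (X : Type) (A : set X) (UU : set_system (X * X)) :
    Prop :=
  forall U : nat -> set (X * X), (forall n, UU (U n)) ->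
  exists x : nat -> X,
    (forall n, A (x n)) /\ \bigcup_n xsection (U n) (x n) = A.

Variant covering_property := Menger | Hurewicz | Rothberger.

Definition bounded_uniformity (P : covering_property) (X : Type) (A : set X)
    (UU : set_system (X * X)) : Prop :=
  match P with
  | Menger => Menger_bounded A UU
  | Hurewicz => Hurewicz_bounded A UU
  | Rothberger => Rothberger_bounded A UU
  end.

Definition bounded_subspace (P : covering_property) (X : uniformType)
    (A : set X) : Prop :=
  bounded_uniformity P A (relative_uniformity A).

Definition locally_bounded (P : covering_property) (X : uniformType) : Prop :=
  forall x : X, exists2 U, uniformity U & bounded_subspace P (xsection U x).

Definition Lindelof (X : topologicalType) (A : set X) : Prop :=
  forall C : set (set X), C `<=` open -> A `<=` \bigcup_(U in C) U ->
  exists D : set (set X),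
    [/\ D `<=` C, countable D & A `<=` \bigcup_(U in D) U].

Definition closed_map (X Y : topologicalType) (f : X -> Y) : Prop :=
  forall C : set X, closed C -> closed (f @` C).

Definition weakly_perfect (X Y : topologicalType) (f : X -> Y) : Prop :=
  [/\ set_surj setT setT f, continuous f, closed_map f &
      forall y : Y, Lindelof (f @^-1` [set y])].

Definition bi_quotient (X Y : topologicalType) (f : X -> Y) : Prop :=
  [/\ set_surj setT setT f, continuous f &
      forall (y : Y) (C : set (set X)),
        C `<=` open -> f @^-1` [set y] `<=` \bigcup_(U in C) U ->
        exists (D : set (set X)) (O : set Y),
          [/\ D `<=` C, finite_set D, open O, O y &
              O `<=` \bigcup_(U in D) (f @` U)]].

(* Main.v *)
(** Call a set [A] bounded in [X] when the covering property holds for covers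
    of [A] by balls centred anywhere in [X]. Up to halving entourages this is
    boundedness of the subspace [A], and it passes to subsets, to images under
    uniformly continuous maps and to countable unions. Both kinds of map in the
    theorem give, for each [y], countably many bounded open sets whose images
    cover a neighbourhood of [y]. *)
Require Import Defs.
From mathcomp Require Import all_boot all_classical topology.

Set Implicit Arguments.
Unset Strict Implicit.
Unset Printing Implicit Defensive.

Local Open Scope classical_set_scope.

(** Together with [covers], this separates the three properties into a condition on the centres and
    a way of covering, so that most arguments avoid a case analysis. *)
Definition admissible (P : covering_property) (X : Type) (F : nat -> set X) :
    Prop :=
  match P with
  | Rothberger => forall n, exists x, F n = [set x]
  | _ => forall n, finite_set (F n)
  end.

Definition covers (P : covering_property) (X : Type) (B : nat -> set X) :
    set X :=
  match P with
  | Hurewicz => [set x | \forall n \near \oo, B n x]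
  | _ => \bigcup_n B n
  end.

Definition bounded_in (P : covering_property) (X : uniformType) (A : set X) :
    Prop :=
  forall U : nat -> set (X * X), (forall n, entourage (U n)) ->
  exists2 F : nat -> set X,
    admissible P F & A `<=` covers P (fun n => uball (U n) (F n)).

(** The map [g] may vary with [n] because moving centres into a subspace depends on the entourage of
    each stage. *)
Lemma admissible_image (P : covering_property) (X Y : Type) (F : nat -> set X)
    (g : nat -> X -> Y) :
  admissible P F -> admissible P (fun n => g n @` F n).
Proof.
by case: P => adF n /=; do ?[exact: finite_image];
  have [x ->] := adF n; exists (g n x); rewrite image_set1.
Qed.

Lemma sub_covers (P : covering_property) (X Y : Type) (B : nat -> set X)
    (C : nat -> set Y) (x : X) (y : Y) :
  (forall n, B n x -> C n y) -> covers P B x -> covers P C y.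
Proof.
move=> BC; case: P => /=; try by move=> [n _ Bx]; exists n => //; exact: BC.
by apply: filterS => n; exact: BC.
Qed.

Lemma uballP (X : Type) (U : set (X * X)) (F : set X) (y : X) :
  uball U F y <-> exists2 x, F x & U (x, y).
Proof.
by split=> -[x Fx]; [move=> /xsectionP | move=> Uxy]; exists x => //;
  exact/xsectionP.
Qed.

(** Relations contained in the square of [A] have all their balls inside [A], so covering [A] and
    having union equal to [A] amount to the same. *)
Lemma bounded_uniformityP (P : covering_property) (X : Type) (A : set X)
    (UU : set_system (X * X)) :
  (forall U, UU U -> U `<=` A `*` A) ->
  bounded_uniformity P A UU <->
  forall U : nat -> set (X * X), (forall n, UU (U n)) ->
  exists F : nat -> set X, [/\ admissible P F, forall n, F n `<=` A &
    A `<=` covers P (fun n => uball (U n) (F n))].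
Proof.
move=> UUA.
have uballA U F : UU U -> uball U F `<=` A.
  by move=> /UUA UA y /uballP[x _ /UA[]].
case: P; split=> bA U UUU; have := bA U UUU.
- move=> [F [finF coverF]]; exists F.
  by split=> [n|n|]; [case: (finF n)..|rewrite -coverF].
- move=> [F [finF FA coverF]]; exists F; split=> //.
  by apply/seteqP; split=> // y [n _]; exact: uballA.
- by move=> [F [finF coverF]]; exists F; split=> // n; case: (finF n).
- by move=> [F [finF FA coverF]]; exists F.
- move=> [x [Ax coverx]]; exists (fun n => [set x n]); split=> [n|n _ ->//|].
    by exists (x n).
  by rewrite -{1}coverx => y [n _ Uxy]; exists n => //; exists (x n).
- move=> [F [/choice[x Fx] FA coverF]]; exists x; split=> [n|].
    by apply: (FA n); rewrite Fx.
  apply/seteqP; split=> [y [n _ /xsectionP/(UUA _ (UUU n))[]//]|y /coverF].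
  by move=> [n _]; rewrite Fx => -[_ -> Uxy]; exists n.
Qed.

Lemma uniformityI_inv (X : uniformType) (U : set (X * X)) :
  entourage U -> uniformity (U `&` U^-1%relation).
Proof.
move=> entU; split; first exact: entourage_invI.
by apply/seteqP; split=> -[x y] [].
Qed.

(* Nonemptiness matters only for [Rothberger]: the centres [x n] have to be
   chosen in [A]. *)
Lemma bounded_subspaceP (P : covering_property) (X : uniformType) (A : set X) :
  A !=set0 -> bounded_subspace P A <-> bounded_in P A.
Proof.
move=> [a0 Aa0].
have sub U : relative_uniformity A U -> U `<=` A `*` A by move=> [V _ <-] ? [].
apply: (iff_trans (bounded_uniformityP P sub)); split=> bA U entU.
  pose W n := (A `*` A) `&` (U n `&` (U n)^-1%relation).
  have [|F [adF _ coverF]] := bA W.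
    by move=> n; exists (U n `&` (U n)^-1%relation) => //; exact: uniformityI_inv.
  exists F => // y /coverF; apply: sub_covers => n /uballP[x Fx [_ [Uxy _]]].
  by apply/uballP; exists x.
have /choice[W WU] n : exists W, uniformity W /\ (A `*` A) `&` W = U n.
  by have [W ? <-] := entU n; exists W.
have entW n : entourage (split_ent (W n)).
  by apply: entourage_split_ent; case: (WU n) => -[].
have [F adF coverF] :=
  bA _ (fun n => (uniformityI_inv (entW n)).1).
(* Each centre [x] is moved to a nearby point of [A], at the cost of one halving. If no point of [A]
   is near [x], its symmetrised ball misses [A], and the default [a0] does no harm. *)
have /choice[g gP] (nx : nat * X) : exists a, A a /\
    forall b, A b -> split_ent (W nx.1) (nx.2, b) ->
    (split_ent (W nx.1))^-1%relation (nx.2, b) -> W nx.1 (a, b).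
  case: nx => n x /=.
  have [[a [Aa Wax]]|noa] := pselect (exists a, A a /\ split_ent (W n) (a, x)).
    exists a; split=> // b Ab Wxb _.
    by apply: (entourage_split x) => //; case: (WU n) => -[].
  by exists a0; split=> // b Ab _ Wbx; case: noa; exists b.
exists (fun n => (fun x => g (n, x)) @` F n); split.
- exact: admissible_image.
- by move=> n _ [x _ <-]; case: (gP (n, x)).
- move=> y Ay; apply: sub_covers (coverF y Ay) => n /uballP[x Fx [Wxy Wyx]].
  apply/uballP; exists (g (n, x)); first by exists x.
  have [Ag gW] := gP (n, x).
  by rewrite -(WU n).2; split=> //; exact: gW.
Qed.

Lemma bounded_in_sub (P : covering_property) (X : uniformType) (A B : set X) :
  A `<=` B -> bounded_in P B -> bounded_in P A.
Proof.
move=> AB bB U entU; have [F adF coverF] := bB U entU.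
by exists F => //; exact: subset_trans coverF.
Qed.

Lemma bounded_in_image (P : covering_property) (X Y : uniformType)
    (f : X -> Y) (A : set X) :
  unif_continuous f -> bounded_in P A -> bounded_in P (f @` A).
Proof.
move=> ucf bA V entV.
have [F adF coverF] := bA _ (fun n => ucf (V n) (entV n)).
exists (fun n => f @` F n); first exact: (admissible_image (fun=> f)).
move=> _ [x Ax <-]; apply: sub_covers (coverF x Ax) => n /uballP[z Fz Vzx].
by apply/uballP; exists (f z) => //; exists z.
Qed.

(** For [Hurewicz], stage [n] uses the centres of the first [n.+1] sets, so a point of [A k] is
    covered at all late stages. [Rothberger] allows only one centre per stage; there, and for
    [Menger], the entourages are split by [pickle] into infinitely many subsequences, one for each
    set. *)
Lemma bounded_in_bigcup_nat (P : covering_property) (X : uniformType)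
    (A : nat -> set X) :
  (forall k, bounded_in P (A k)) -> bounded_in P (\bigcup_k A k).
Proof.
have [->|PH] := pselect (P = Hurewicz) => bA U entU.
  have /choice[F FP] k : exists F : nat -> set X,
      (forall n, finite_set (F n)) /\
      A k `<=` covers Hurewicz (fun n => uball (U n) (F n)).
    by have [F] := bA k U entU; exists F.
  exists (fun n => \bigcup_(k in `I_n.+1) F k n) => [n|y [k _ Aky]] /=.
    by apply: bigcup_finite => // k _; exact: (FP k).1.
  apply: filterS2 (nbhs_infty_ge k) ((FP k).2 y Aky) => n kn /uballP[x Fx Uxy].
  by apply/uballP; exists x => //; exists k.
have /choice[F FP] k : exists F : nat -> set X, admissible P F /\
    A k `<=` covers P (fun m => uball (U (pickle (k, m))) (F m)).
  by have [F ? ?] := bA k (fun m => U (pickle (k, m))) (fun m => entU _); exists F.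
(* An index that codes no pair gets [F 0 0] rather than the empty set, so that [G n] remains a
   singleton for [Rothberger]. *)
pose G n := if unpickle n is Some (k, m) then F k m else F 0 0.
have Gpickle k m : G (pickle (k, m)) = F k m by rewrite /G pickleK.
exists G => [|y [k _ /(FP k).2]].
  have {}FP k := (FP k).1; rewrite /G.
  case: P PH {bA} FP => //= _ FP n; case: (unpickle n) => [[k m]|]; exact: FP.
by case: P PH {bA FP} => //= _ [m _ Fy]; exists (pickle (k, m)) => //;
  rewrite Gpickle.
Qed.

Lemma bounded_in_bigcup (P : covering_property) (X : uniformType)
    (D : set (set X)) :
  D !=set0 -> countable D -> (forall V, D V -> bounded_in P V) ->
  bounded_in P (\bigcup_(V in D) V).
Proof.
move=> [V0 DV0] /pcard_surjP[g gD] bD.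
(* The surjection [g] onto [D] may also take values outside [D]; these are replaced by [V0]. *)
pose A k := if `[< D (g k) >] then g k else V0.
have DA k : D (A k) by rewrite /A; case: asboolP.
apply: (@bounded_in_sub _ _ _ (\bigcup_k A k)) => [x [V DV Vx]|].
  have [k _ gk] := gD _ DV; exists k => //.
  by rewrite /A gk; case: asboolP.
by apply: bounded_in_bigcup_nat => k; exact: bD.
Qed.

(** The ball given by local boundedness need not be open, but its interior still contains [x] and
    inherits boundedness in [X]. *)
Lemma locally_bounded_open (P : covering_property) (X : uniformType) (x : X) :
  locally_bounded P X -> exists V, [/\ open V, V x & bounded_in P V].
Proof.
move=> /(_ x)[U [entU _] bU]; exists (xsection U x)°; split.
- exact: open_interior.
- exact: (nbhs_entourage x entU).
- apply: (bounded_in_sub (@interior_subset _ _)).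
  apply: (bounded_subspaceP P _).1 bU; exists x.
  by apply/xsectionP; exact: entourage_refl.
Qed.

Lemma open_bounded_locally (P : covering_property) (X : uniformType) :
  (forall x : X, exists O, [/\ open O, O x & bounded_in P O]) ->
  locally_bounded P X.
Proof.
move=> bX x; have [O [oO Ox bO]] := bX x.
have : nbhs x O by apply: open_nbhs_nbhs.
rewrite -filter_from_entourageE => -[U entU UO].
exists (U `&` U^-1%relation); first exact: uniformityI_inv.
apply/bounded_subspaceP.
  exists x; apply/xsectionP; apply: entourage_refl; exact: entourage_invI.
by apply: bounded_in_sub bO => y; rewrite xsectionI => -[Uxy _]; exact: UO.
Qed.

(** A common consequence of both hypotheses on [f]; countable subfamilies suffice because
    boundedness passes to countable unions. *)
Definition countably_bi_quotient (X Y : topologicalType) (f : X -> Y) : Prop :=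
  forall (y : Y) (C : set (set X)),
  C `<=` open -> f @^-1` [set y] `<=` \bigcup_(U in C) U ->
  exists (D : set (set X)) (O : set Y),
    [/\ D `<=` C, countable D, open O, O y & O `<=` \bigcup_(U in D) (f @` U)].

Lemma bi_quotient_countably (X Y : topologicalType) (f : X -> Y) :
  bi_quotient f -> countably_bi_quotient f.
Proof.
move=> [_ _ bqf] y C oC coverC.
have [D [O [DC finD oO Oy OD]]] := bqf y C oC coverC.
by exists D, O; split=> //; exact: finite_set_countable.
Qed.

Lemma weakly_perfect_countably (X Y : topologicalType) (f : X -> Y) :
  weakly_perfect f -> countably_bi_quotient f.
Proof.
move=> [surjf _ closedf lindf] y C oC coverC.
have [D [DC cD coverD]] := lindf y C oC coverC.
have oD : open (\bigcup_(U in D) U) by apply: bigcup_open => U /DC /oC.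
(* This is the set of points whose whole fibre lies in the union of [D]; it is open because [f] is
   closed. *)
exists D, (~` (f @` ~` (\bigcup_(U in D) U))); split=> //.
- by apply: closed_openC; apply: closedf; exact: open_closedC.
- by move=> [x nDx fx]; apply: nDx; exact: coverD.
- move=> z nz; have [x _ fx] := surjf z I.
  have [[U DU Ux]|nDx] := pselect ((\bigcup_(U in D) U) x).
    by exists U => //; exists x.
  by case: nz; exists x.
Qed.

Lemma countably_bi_quotient_locally_bounded (P : covering_property)
    (X Y : uniformType) (f : X -> Y) :
  locally_bounded P X -> unif_continuous f -> countably_bi_quotient f ->
  locally_bounded P Y.
Proof.
move=> lbX ucf cbqf; apply: open_bounded_locally => y.
have [|x _|D [O [DC cD oO Oy OD]]] := cbqf y [set V | open V /\ bounded_in P V].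
- by move=> V [].
- by have [V [oV Vx bV]] := locally_bounded_open x lbX; exists V.
exists O; split=> //; apply: (bounded_in_sub OD).
rewrite -image_bigcup; apply: bounded_in_image => //.
apply: bounded_in_bigcup => // [|V /DC[] //].
(* The family [D] is nonempty because the images of its members cover [y]. *)
by have [U DU _] := OD _ Oy; exists U.
Qed.

Theorem theorem4p4 (P : covering_property) (X Y : uniformType)
    (sepX : separated_uniformity X) (sepY : separated_uniformity Y) (lbX : locally_bounded P X) :
  (forall f : X -> Y,
     unif_continuous f -> bi_quotient f -> locally_bounded P Y) /\
  (forall f : X -> Y,
     unif_continuous f -> weakly_perfect f -> locally_bounded P Y).
Proof.
split=> f ucf hf; apply: (countably_bi_quotient_locally_bounded lbX ucf).
- exact: bi_quotient_countably.
- exact: weakly_perfect_countably.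
Qed.
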